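(* Let $U$ be a unitary and let $0<a<1$ be such that $$U|0,0\rangle=a|\psi_0,0\rangle+\sqrt{1-a^2}\,|\psi_1,1\rangle ,$$ where $|\psi_0\rangle,|\psi_1\rangle$ are normalized states and the second register is a flag qubit. There exists a quantum algorithm which estimates $a$ to within error $\epsilon$ with probability of error less than $\delta$, using $$N=\frac{\pi}{\epsilon}\sqrt{1+\alpha^2}=\frac{1}{2\epsilon}\ln(1/\delta)+\mathcal{O}\!\left(\epsilon^{-1}\ln\ln(1/\delta)\right)$$ calls to $U$ or $U^\dagger$.
   Context: Here $\alpha>0$ is a real parameter (the parameter of a Kaiser window) depending only on $\delta$, with $\alpha=\frac{1}{2\pi}\ln(1/\delta)+\mathcal{O}(\ln\ln(1/\delta))$ as $\delta\to 0$. The algorithm may use controlled applications of $U$ and $U^\dagger$, arbitrary other unitaries independent of $U$ (e.g. reflections about $|0,0\rangle$ and on the flag qubit, quantum Fourier transforms, preparation of ancilla states) and measurements, none of which are counted. ''Error'' means that the output estimate $\hat a$ satisfies $|\hat a-a|>\epsilon$. *)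

(* Defs.v *)
From mathcomp Require Export all_boot all_order all_algebra.
From mathcomp Require Export all_classical all_reals all_analysis.
From mathcomp Require Export complex mxtens.
Set Implicit Arguments.
Unset Strict Implicit.
Unset Printing Implicit Defensive.
Import Order.TTheory GRing.Theory Num.Theory.
Local Open Scope ring_scope.
Local Open Scope sesquilinear_scope.
Local Open Scope complex_scope.

Definition sqnorm (R : realType) (n : nat) (psi : 'cV[R[i]]_n) : R :=
  \sum_(i < n) (complex.Re (psi i ord0) ^+ 2 + complex.Im (psi i ord0) ^+ 2).

(* Basis state |i>. *)
Definition ket (R : realType) (n : nat) (i : 'I_n) : 'cV[R[i]]_n :=
  delta_mx i ord0.

(* Tensor product of states; the type identifies the width [1 * 1] of [*t]
   with [1] by computation. *)
Definition tensv (R : realType) (m n : nat)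
    (u : 'cV[R[i]]_m) (v : 'cV[R[i]]_n) : 'cV[R[i]]_(m * n) :=
  (u *t v : 'M[R[i]]_(m * n, 1 * 1)).

(* sum_(i in c) |i><i| (x) V + sum_(i notin c) |i><i| (x) 1: V is applied to the
   second register when the first one is in a basis state of [c].  With
   [c = setT] this is the uncontrolled V, and a control qubit inside the first
   register is obtained by taking for [c] the labels whose control bit is 1. *)
Definition controlled (R : realType) (w d : nat) (c : {set 'I_w})
    (V : 'M[R[i]]_d) : 'M[R[i]]_(w * d) :=
  diag_mx (\row_(i < w) (i \in c)%:R) *t V
  + diag_mx (\row_(i < w) (i \notin c)%:R) *t 1%:M.

(* Quantum query algorithms with a workspace of dimension w and access to an
   unknown unitary acting on a target register of dimension d.  Free unitaries
   act on both registers and are fixed before the unknown unitary is given.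
   [Measure f] observes only the value of [f] on the basis label of the joint
   register; combined with free unitaries this gives every projective
   measurement.  What follows a measurement may depend on its outcome. *)
Inductive qalg (R : realType) (w d : nat) : Type :=
| Output (x : R)
| Apply (V : 'M[R[i]]_(w * d)) (_ : V \is unitarymx) (A : qalg R w d)
| Call (c : {set 'I_w}) (A : qalg R w d)
| CallDagger (c : {set 'I_w}) (A : qalg R w d)
| Measure (k : nat) (f : 'I_(w * d) -> 'I_k) (A : 'I_k -> qalg R w d).

(* Number of calls to U or U^dagger, maximised over measurement outcomes. *)
Fixpoint calls (R : realType) (w d : nat) (A : qalg R w d) : nat :=
  match A with
  | Output _ => 0
  | Apply _ _ A' => calls A'
  | Call _ A' => (calls A').+1
  | CallDagger _ A' => (calls A').+1
  | Measure k _ A' => \max_(i < k) calls (A' i)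
  end.

(* Probability that the output of A satisfies E when A is run from psi with the
   unknown unitary U.  States are not renormalised after a measurement, so psi
   carries the probability sqnorm psi of the branch that led to it. *)
Fixpoint prob_output (R : realType) (w d : nat) (U : 'M[R[i]]_d) (E : pred R)
    (A : qalg R w d) (psi : 'cV[R[i]]_(w * d)) : R :=
  match A with
  | Output x => if E x then sqnorm psi else 0
  | Apply V _ A' => prob_output U E A' (V *m psi)
  | Call c A' => prob_output U E A' (controlled c U *m psi)
  | CallDagger c A' => prob_output U E A' (controlled c (U^t*) *m psi)
  | Measure k f A' =>
      \sum_(i < k) prob_output U E (A' i)
        (\col_j (if f j == i then psi j ord0 else 0))
  end.

(* U |0,0> = a |psi0,0> + sqrt(1-a^2) |psi1,1>, where the target register is a
   system of dimension n+1 tensored with the flag qubit. *)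
Definition prepares (R : realType) (n : nat) (U : 'M[R[i]]_(n.+1 * 2)) (a : R)
    (psi0 psi1 : 'cV[R[i]]_n.+1) : Prop :=
  U *m tensv (ket R ord0) (ket R ord0)
  = a%:C *: tensv psi0 (ket R (ord0 : 'I_2))
    + (Num.sqrt (1 - a ^+ 2))%:C *: tensv psi1 (ket R (ord_max : 'I_2)).

(* |0> of the workspace, |0,0> of the target register. *)
Definition init_state (R : realType) (w n : nat) :
    'cV[R[i]]_(w.+1 * (n.+1 * 2)) :=
  tensv (ket R ord0) (tensv (ket R ord0) (ket R ord0)).

Definition query_bound (R : realType) (alpha eps : R) : R :=
  pi / eps * Num.sqrt (1 + alpha ^+ 2).

(* Main.v *)
(* Phase estimation with a Chebyshev window.  Write a = cos theta.  The reflection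
   of the flag and the reflection about U|0,0> (two calls) compose to a rotation
   by 2 theta of the real plane spanned by |psi0,0> and |psi1,1>.  A workspace of
   dimension 2K+1 runs this rotation k-K times in branch k, with only 2K+1 calls,
   because rotating forwards and backwards share their calls.  A Fourier transform
   of the workspace then yields y with probability proportional to
   |W(e^(2ix))|^2, x = +-theta - pi y / (2K+1), W being the polynomial of the
   initial amplitudes, and |cos (pi y / (2K+1))| estimates a.

   With W(e^(2ix)) = e^(iMx) T_M(b cos x) D_m(x), T_M the Chebyshev polynomial and
   D_m the Dirichlet kernel, an estimate off by more than eps has
   |cos x| <= 1 - eps^2/2, so |T_M| <= 1 there when b (1 - eps^2/2) <= 1.
   Parseval for D_m bounds the failure probability by m / ||W||^2, and
   Cauchy-Schwarz gives ||W||^2 >= (m T_M(b))^2 / (2K+1), where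
   T_M(b) >= e^(M eps) / 2.  Taking m ~ 1/eps keeps the prefactor polynomial in
   N eps without affecting the exponent, so a parameter alpha exceeding
   ln(1/delta) / (2 pi) by O(ln ln(1/delta)) suffices. *)
Require Import Defs.
From mathcomp Require Import ring lra zify.
Set Implicit Arguments.
Unset Strict Implicit.
Unset Printing Implicit Defensive.
Import Order.TTheory GRing.Theory Num.Theory.
Import numFieldNormedType.Exports.
Local Open Scope classical_set_scope.
Local Open Scope ring_scope.
Local Open Scope sesquilinear_scope.
Local Open Scope complex_scope.

(** * Unitary matrices and reflections *)

Section LinearAlgebra.
Variable R : realType.
Local Notation C := R[i].

Definition sqmod (z : C) : R := complex.Re z ^+ 2 + complex.Im z ^+ 2.

Lemma sqmodE (z : C) : (sqmod z)%:C = z^* * z.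
Proof. by rewrite /sqmod add_Re2_Im2 sqr_normc mulrC. Qed.

Lemma sqmod_ge0 z : 0 <= sqmod z.
Proof. by rewrite addr_ge0 ?sqr_ge0. Qed.

Lemma sqmodM z1 z2 : sqmod (z1 * z2) = sqmod z1 * sqmod z2.
Proof. by case: z1 z2 => [a b] [c d]; rewrite /sqmod /=; ring. Qed.

Lemma sqmod_real (x : R) : sqmod x%:C = x ^+ 2.
Proof. by rewrite /sqmod /= expr0n addr0. Qed.

(** Parallelogram law for [z1] and ['i * z2]; it later trades cosine and sine components for
    exponentials. *)
Lemma sqmodDi (z1 z2 : C) :
  sqmod z1 + sqmod z2 =
  (sqmod (z1 + 'i%C * z2) + sqmod (z1 - 'i%C * z2)) / 2.
Proof. by case: z1 z2 => [a b] [c d]; rewrite /sqmod /=; field. Qed.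

Lemma sqnorm_ge0 n (v : 'cV[C]_n) : 0 <= sqnorm v.
Proof. by apply: sumr_ge0 => i _; exact: sqmod_ge0. Qed.

Lemma sqnormE n (v : 'cV[C]_n) : (sqnorm v)%:C%:M = v^t* *m v.
Proof.
apply/matrixP => i j; rewrite !ord1 !mxE eqxx mulr1n rmorph_sum /=.
by apply: eq_bigr => k _; rewrite !mxE; exact: sqmodE.
Qed.

Lemma sqnormZ n (c : C) (v : 'cV[C]_n) : sqnorm (c *: v) = sqmod c * sqnorm v.
Proof.
by rewrite /sqnorm mulr_sumr; apply: eq_bigr => i _; rewrite mxE; exact: sqmodM.
Qed.

Lemma mulmx_ctr_unitary n (V : 'M[C]_n) : V \is unitarymx -> V^t* *m V = 1%:M.
Proof. by rewrite -trmxC_unitary => /unitarymxP; rewrite trmxCK. Qed.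

Lemma ctr_mul m n p (A : 'M[C]_(m, n)) (B : 'M[C]_(n, p)) :
  (A *m B)^t* = B^t* *m A^t*.
Proof. by rewrite trmx_mul map_mxM. Qed.

Lemma ctrD m n (A B : 'M[C]_(m, n)) : (A + B)^t* = A^t* + B^t*.
Proof. by apply/matrixP => i j; rewrite !mxE rmorphD. Qed.

Lemma sqnorm_unitary n (V : 'M[C]_n) (v : 'cV[C]_n) :
  V \is unitarymx -> sqnorm (V *m v) = sqnorm v.
Proof.
move=> /mulmx_ctr_unitary VV.
have /matrixP/(_ ord0 ord0) := sqnormE (V *m v).
rewrite ctr_mul mulmxA -(mulmxA (v^t*)) VV mulmx1 -sqnormE !mxE eqxx !mulr1n.
exact: complexI.
Qed.

Lemma ctr_tens m n p q (A : 'M[C]_(m, n)) (B : 'M[C]_(p, q)) :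
  (A *t B)^t* = A^t* *t B^t*.
Proof. by apply/matrixP => i j; rewrite !mxE rmorphM. Qed.

Lemma tensmx11 m n : (1%:M : 'M[C]_m) *t (1%:M : 'M[C]_n) = 1%:M.
Proof.
apply/matrixP => i j.
case: (mxtens_indexP i) => i1 i2; case: (mxtens_indexP j) => j1 j2.
rewrite tensmxE !mxE -natrM mulnb; congr (nat_of_bool _)%:R.
by rewrite (can_eq (@mxtens_indexK m n)) xpair_eqE.
Qed.

Lemma unitary_tens m n (A : 'M[C]_m) (B : 'M[C]_n) :
  A \is unitarymx -> B \is unitarymx -> A *t B \is unitarymx.
Proof.
move=> /unitarymxP AA /unitarymxP BB; apply/unitarymxP.
by rewrite ctr_tens tensmx_mul AA BB tensmx11.
Qed.

Lemma unitary1 n : (1%:M : 'M[C]_n) \is unitarymx.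
Proof. by apply/unitarymxP; rewrite mul1mx trmx1 map_mx1. Qed.

Lemma sum_mxtens (V : nmodType) m n (F : 'I_(m * n) -> V) :
  \sum_i F i = \sum_i \sum_j F (mxtens_index (i, j)).
Proof.
rewrite pair_big /= (reindex (@mxtens_index m n)) /=; first by apply: eq_bigr => -[].
by exists (@mxtens_unindex m n) => i _; rewrite (mxtens_indexK, mxtens_unindexK).
Qed.

Definition reflector n (u : 'cV[C]_n) : 'M[C]_n := (u *m u^t*) *+ 2 - 1%:M.

Lemma reflector_unitary n (u : 'cV[C]_n) :
  sqnorm u = 1 -> reflector u \is unitarymx.
Proof.
move=> u1; apply/unitarymxP.
have Pu : (u *m u^t*) *m (u *m u^t*) = u *m u^t*.
  by rewrite mulmxA -(mulmxA u) -sqnormE u1 mulmx1.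
have -> : (reflector u)^t* = reflector u.
  rewrite /reflector linearB /= map_mxB linearMn /= raddfMn /= trmx1 map_mx1.
  by rewrite [X in X *+ 2]ctr_mul trmxCK.
rewrite /reflector; move: (u *m _) Pu => P Pu.
rewrite !(mulmxBl, mulmxBr) mul1mx !mulmx1.
have -> : (P *+ 2) *m (P *+ 2) = P *+ 4.
  by rewrite -[P *+ 2]scaler_nat -scalemxAl -scalemxAr Pu scalerA -natrM scaler_nat.
by apply/matrixP => i j; rewrite !mxE; ring.
Qed.

Lemma reflectorE n (u v : 'cV[C]_n) (c : C) :
  u^t* *m v = c%:M -> reflector u *m v = (c *+ 2) *: u - v.
Proof.
move=> uv; rewrite mulmxBl mul1mx -scaler_nat -scalemxAl -mulmxA uv.
by rewrite mul_mx_scalar scalerA mulr_natl.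
Qed.

(** With one call to [V] and one to its adjoint, a reflection about a known vector becomes the
    reflection about the vector that [V] prepares. *)
Lemma conj_reflector n (V : 'M[C]_n) (u : 'cV[C]_n) : V \is unitarymx ->
  V *m reflector u *m V^t* = reflector (V *m u).
Proof.
move=> /unitarymxP VV; rewrite /reflector mulmxBr mulmx1 mulmxBl VV ctr_mul.
by rewrite !mulr2n mulmxDr mulmxDl !mulmxA.
Qed.

Lemma unitaryN1 n : (- 1%:M : 'M[C]_n) \is unitarymx.
Proof.
apply/unitarymxP; rewrite linearN /= map_mxN mulNmx mulmxN opprK.
by rewrite trmx1 map_mx1 mulmx1.
Qed.

Lemma ctr_ket n (i : 'I_n) (v : 'cV[C]_n) : (ket R i)^t* *m v = (v i ord0)%:M.
Proof.
rewrite /ket trmx_delta map_delta_mx -rowE; apply/matrixP => j k.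
by rewrite !ord1 !mxE eqxx mulr1n.
Qed.

Lemma sqnorm_eq0 n (v : 'cV[C]_n) : sqnorm v = 0 -> v = 0.
Proof.
move=> /psumr_eq0P v0; apply/matrixP => i j; rewrite ord1 mxE.
have /eqP : sqmod (v i ord0) = 0 by apply: v0 => // k _; exact: sqmod_ge0.
rewrite paddr_eq0 ?sqr_ge0 // !sqrf_eq0 => /andP[/eqP re0 /eqP im0].
by apply/eqP; rewrite eq_complex re0 im0 !eqxx.
Qed.

(* Householder reflection along [ket ord0 + v]. *)
Lemma exists_unitary_col n (v : 'cV[C]_n.+1) :
  sqnorm v = 1 -> complex.Im (v ord0 ord0) = 0 ->
  exists2 V : 'M[C]_n.+1, V \is unitarymx & V *m ket R ord0 = v.
Proof.
move=> v1 im0; pose e : 'cV[C]_n.+1 := ket R ord0.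
have [x vx] : exists x : R, v ord0 ord0 = x%:C.
  by exists (complex.Re (v ord0 ord0)); apply/eqP; rewrite eq_complex /= im0 !eqxx.
have e00 : e ord0 ord0 = 1 by rewrite mxE !eqxx.
have ev : e^t* *m v = x%:C%:M by rewrite ctr_ket vx.
have ee : e^t* *m e = 1%:M by rewrite ctr_ket e00.
have ve : v^t* *m e = x%:C%:M.
  rewrite -[LHS]trmxCK ctr_mul trmxCK ev; apply/matrixP => i j.
  by rewrite !ord1 !mxE eqxx !mulr1n /=; exact: conjc_real.
pose u := e + v; pose s := sqnorm u.
have sE : s = 2 * (1 + x).
  have /matrixP/(_ ord0 ord0) := sqnormE u.
  rewrite /u ctrD mulmxDl !mulmxDr ee ev ve -sqnormE v1 !mxE eqxx !mulr1n.
  rewrite -/s => sE; apply: complexI; rewrite sE !rmorphM rmorphD /= !rmorph1; ring.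
(* If [s = 0] then [v = - ket R ord0]: the axis [u] vanishes and minus the identity serves
   instead. *)
have [s0|s0] := eqVneq s 0.
  exists (- 1%:M); first exact: unitaryN1.
  rewrite mulNmx mul1mx; apply/esym/eqP; rewrite -addr_eq0 addrC.
  by apply/eqP/sqnorm_eq0.
have s_gt0 : 0 < s by rewrite lt_neqAle eq_sym s0 sqnorm_ge0.
pose r := (Num.sqrt s)^-1.
exists (reflector (r%:C *: u)).
  apply: reflector_unitary; rewrite sqnormZ sqmod_real exprVn sqr_sqrtr ?ltW //.
  by rewrite mulVf.
(* [r * (1 + x)] is the product of the unit axis with [ket R ord0]; as [s = 2 * (1 + x)], the
   coefficient of [u] becomes 1. *)
rewrite (reflectorE (c := (r * (1 + x))%:C)).
  rewrite scalerA -rmorphMn -rmorphM.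
  have -> : (r * (1 + x)) *+ 2 * r = 1.
    have : r ^+ 2 * s = 1 by rewrite exprVn sqr_sqrtr ?ltW // mulVf.
    by move=> rs; rewrite -[RHS]rs sE; ring.
  by rewrite scale1r /u -/e [e + v]addrC addrK.
have -> : (r%:C *: u)^t* = r%:C *: u^t*.
  by apply/matrixP => i j; rewrite !mxE rmorphM /=; congr (_ * _); exact: conjc_real.
rewrite -scalemxAl ctrD mulmxDl ee ve.
apply/matrixP => i j; rewrite !ord1 !mxE eqxx !mulr1n rmorphM rmorphD /= rmorph1.
by [].
Qed.
End LinearAlgebra.

(** * States of workspace and target *)

Section JointStates.
Variables (R : realType) (w d : nat).
Local Notation C := R[i].

(* sum_(k < w) |k> (x) f k *)
Definition joint (f : 'I_w -> 'cV[C]_d) : 'cV[C]_(w * d) :=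
  \col_p f (mxtens_unindex p).1 (mxtens_unindex p).2 ord0.

Definition blockdiag (V : 'I_w -> 'M[C]_d) : 'M[C]_(w * d) :=
  \matrix_(p, q) (((mxtens_unindex p).1 == (mxtens_unindex q).1)%:R
    * V (mxtens_unindex p).1 (mxtens_unindex p).2 (mxtens_unindex q).2).

Lemma eq_joint (f g : 'I_w -> 'cV[C]_d) : f =1 g -> joint f = joint g.
Proof. by move=> fg; apply/matrixP => p q; rewrite !mxE fg. Qed.

Lemma blockdiag_joint V f :
  blockdiag V *m joint f = joint (fun k => V k *m f k).
Proof.
apply/matrixP => p q; case: (mxtens_indexP p) => k j; rewrite !mxE sum_mxtens.
rewrite !mxtens_indexK /= (bigD1 k) //= [X in _ + X]big1 ?addr0 => [|l lk].
  by apply: eq_bigr => i _; rewrite !mxE !mxtens_indexK /= eqxx mul1r.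
by apply: big1 => i _; rewrite !mxE !mxtens_indexK /= eq_sym (negbTE lk) !mul0r.
Qed.

Lemma unitary_blockdiag V :
  (forall k, V k \is unitarymx) -> blockdiag V \is unitarymx.
Proof.
move=> VV; apply/unitarymxP/matrixP => p q; rewrite !mxE sum_mxtens.
case: (mxtens_indexP p) => k i; case: (mxtens_indexP q) => l j.
rewrite (can_eq (@mxtens_indexK w d)) xpair_eqE (bigD1 k) //= [X in _ + X]big1 ?addr0; last first.
  move=> m mk; apply: big1 => h _; rewrite !mxE !mxtens_indexK /=.
  by rewrite eq_sym (negbTE mk) !mul0r.
have [<-|kl] := eqVneq k l; last first.
  apply: big1 => h _; rewrite !mxE !mxtens_indexK /= eq_sym (negbTE kl).
  by rewrite mul0r rmorph0 mulr0.
have /unitarymxP/matrixP/(_ i j) := VV k; rewrite !mxE => <-.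
apply: eq_bigr => h _; rewrite !mxE !mxtens_indexK /= eqxx !mul1r.
by [].
Qed.

Lemma controlledE (c : {set 'I_w}) (V : 'M[C]_d) :
  controlled c V = blockdiag (fun k => if k \in c then V else 1%:M).
Proof.
apply/matrixP => p q.
case: (mxtens_indexP p) => k i; case: (mxtens_indexP q) => l j.
rewrite !mxE !mxtens_indexK /=; have [_|_] := eqVneq k l.
  by rewrite !mulr1n !mul1r; case: (k \in c); rewrite /= ?mxE ?mul1r ?mul0r ?addr0 ?add0r.
by rewrite !mulr0n !mul0r addr0.
Qed.

Lemma controlled_joint (c : {set 'I_w}) (V : 'M[C]_d) f :
  controlled c V *m joint f
  = joint (fun k => (if k \in c then V else 1%:M) *m f k).
Proof. by rewrite controlledE blockdiag_joint. Qed.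

Lemma tens_joint (F : 'M[C]_w) f :
  (F *t 1%:M) *m joint f = joint (fun y => \sum_k F y k *: f k).
Proof.
apply/matrixP => p q; case: (mxtens_indexP p) => y j; rewrite !mxE sum_mxtens.
rewrite !mxtens_indexK /= summxE; apply: eq_bigr => k _.
rewrite (bigD1 j) //= [X in _ + X]big1 ?addr0 => [|i ij].
  by rewrite !mxE !mxtens_indexK /= ?mxE eqxx mulr1.
by rewrite !mxE !mxtens_indexK /= ?mxE eq_sym (negbTE ij) mulr0 mul0r.
Qed.

Lemma sqnorm_joint_proj f (y : 'I_w) :
  sqnorm (\col_p (if (mxtens_unindex p).1 == y then joint f p ord0 else 0))
  = sqnorm (f y).
Proof.
pose g k j := if k == y then f k j ord0 else 0.
transitivity (\sum_k \sum_j sqmod (g k j)).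
  rewrite /sqnorm sum_mxtens; apply: eq_bigr => k _; apply: eq_bigr => j _.
  by rewrite mxE mxtens_indexK mxE mxtens_indexK.
rewrite /g (bigD1 y) //= [X in _ + X]big1 ?addr0 ?eqxx // => k /negbTE ->.
by apply: big1 => j _; rewrite /sqmod /= expr0n addr0.
Qed.

End JointStates.

(** * Product states and the flag qubit *)

Section Tensv.
Variable R : realType.
Local Notation C := R[i].

Lemma tensvE m n (u : 'cV[C]_m) (v : 'cV[C]_n) i j :
  tensv u v (mxtens_index (i, j)) ord0 = u i ord0 * v j ord0.
Proof. by rewrite mxE mxtens_indexK; congr (u _ _ * v _ _); rewrite ord1. Qed.

Lemma init_stateE w n :
  init_state R w n
  = joint (fun k => (k == ord0)%:R *: tensv (ket R ord0) (ket R ord0)).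
Proof.
apply/matrixP => p q; rewrite ord1; case: (mxtens_indexP p) => k i.
by rewrite tensvE [RHS]mxE mxtens_indexK [RHS]mxE [in LHS]mxE eqxx andbT.
Qed.

Lemma sqnorm_tens_flag n (u v : 'cV[C]_n) (x y : C) :
  sqnorm (x *: tensv u (ket R (ord0 : 'I_2)) + y *: tensv v (ket R (ord_max : 'I_2)))
  = sqmod x * sqnorm u + sqmod y * sqnorm v.
Proof.
rewrite /sqnorm sum_mxtens !mulr_sumr -big_split /=; apply: eq_bigr => i _.
rewrite !big_ord_recl big_ord0 addr0 -!sqmodM.
by congr (_ + _); rewrite /sqmod; congr (complex.Re _ ^+ 2 + complex.Im _ ^+ 2);
  rewrite mxE [X in X + _]mxE [X in _ + X]mxE !tensvE !mxE /= ?mulr1 ?mulr0 ?addr0 ?add0r.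
Qed.

(** Pauli Z on the flag qubit. *)
Definition flagflip n : 'M[C]_(n * 2) :=
  blockdiag (fun _ : 'I_n => diag_mx (\row_(b < 2) (-1) ^+ b)).

Lemma flagflip_unitary n : flagflip n \is unitarymx.
Proof.
apply: unitary_blockdiag => _; apply/unitarymxP.
rewrite tr_diag_mx map_diag_mx mulmx_diag; apply/matrixP => i j; rewrite !mxE.
by rewrite rmorphXn rmorphN1 -exprMn mulrNN mulr1 expr1n.
Qed.

Lemma tensv_joint n m (u : 'cV[C]_n) (v : 'cV[C]_m) :
  tensv u v = joint (fun k => u k ord0 *: v).
Proof.
apply/matrixP => p q; rewrite ord1; case: (mxtens_indexP p) => k i.
by rewrite tensvE !mxE mxtens_indexK.
Qed.

Lemma flagflip_tens n (u : 'cV[C]_n) (b : 'I_2) :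
  flagflip n *m tensv u (ket R b) = (-1) ^+ b *: tensv u (ket R b).
Proof.
rewrite tensv_joint blockdiag_joint; apply/matrixP => p q; rewrite ord1.
case: (mxtens_indexP p) => k i; rewrite [LHS]mxE [RHS]mxE [in RHS]mxE.
rewrite mxtens_indexK mul_diag_mx !mxE; case: eqVneq => [->|_]; last by rewrite !mulr0.
by rewrite mulrCA.
Qed.

Lemma ctr_tensv m n (u v : 'cV[C]_m) (x y : 'cV[C]_n) (a b : C) :
  u^t* *m v = a%:M -> x^t* *m y = b%:M ->
  (tensv u x)^t* *m tensv v y = (a * b)%:M.
Proof.
move=> uv xy; apply/matrixP => i j; rewrite !ord1 !mxE sum_mxtens eqxx mulr1n.
have <- : (u^t* *m v) ord0 ord0 = a by rewrite uv mxE eqxx mulr1n.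
have <- : (x^t* *m y) ord0 ord0 = b by rewrite xy mxE eqxx mulr1n.
rewrite !mxE mulr_suml; apply: eq_bigr => k _; rewrite mulr_sumr.
apply: eq_bigr => l _; rewrite tensvE !mxE mxtens_indexK rmorphM !ord1.
by rewrite mulrACA.
Qed.

End Tensv.

(** * The query algorithm *)

Lemma ctr_orthonormal_comb (R : realType) m (u v : 'cV[R[i]]_m) (x y x' y' : R) :
  u^t* *m u = 1%:M -> v^t* *m v = 1%:M -> u^t* *m v = 0 -> v^t* *m u = 0 ->
  (x%:C *: u + y%:C *: v)^t* *m (x'%:C *: u + y'%:C *: v) = (x * x' + y * y')%:C%:M.
Proof.
move=> uu vv uv vu.
have ctrZ (z : R) (e : 'cV_m) : (z%:C *: e)^t* = z%:C *: e^t*.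
  by apply/matrixP => i j; rewrite !mxE rmorphM; congr (_ * _); exact: conjc_real.
rewrite ctrD !ctrZ mulmxDl !mulmxDr.
have ZZ (z z' : R[i]) (e f : 'cV_m) : (z *: e^t* ) *m (z' *: f) = (z * z') *: (e^t* *m f).
  by rewrite -scalemxAl -scalemxAr scalerA.
rewrite !ZZ uu vv uv vu !scaler0 addr0 add0r -scalerDl -!rmorphM -rmorphD.
by rewrite scale_scalar_mx mulr1.
Qed.

(** One of the two truncated differences is always zero, so together they encode a signed number of
    rotations. *)
Lemma natrB_subn (R : pzRingType) (j k : nat) :
  (j - k)%N%:R - (k - j)%N%:R = j%:R - k%:R :> R.
Proof.
case: (leqP j k) => [jk|/ltnW jk].
  by rewrite (eqP jk) natrB // sub0r opprB.
by rewrite (eqP jk) natrB // subr0.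
Qed.

Section Algorithm.
Variables (R : realType) (n K : nat).
Local Notation C := R[i].
Local Notation w := (K.*2).+1.
Local Notation d := (n.+1 * 2)%N.

Definition target0 : 'cV[C]_d := tensv (ket R ord0) (ket R ord0).

Lemma sqnorm_target0 : sqnorm target0 = 1.
Proof.
have ket1 m : (ket R (ord0 : 'I_m.+1))^t* *m ket R ord0 = 1%:M.
  by rewrite ctr_ket mxE !eqxx.
have /matrixP/(_ ord0 ord0) := sqnormE target0.
rewrite (ctr_tensv (ket1 _) (ket1 _)) mulr1 !mxE eqxx !mulr1n.
exact: complexI.
Qed.

(** Label [k] asks for [k - K] rotations: step [r] turns branch [k] forwards when [r < k - K] and,
    symmetrically, backwards when [r < K - k]. *)
Definition forward (r : nat) (k : 'I_w) := (K + r < k)%N.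
Definition backward (r : nat) (k : 'I_w) := (k + r < K)%N.

Definition apply_if (p : pred 'I_w) (V : 'M[C]_d) : 'M[C]_(w * d) :=
  blockdiag (fun k => if p k then V else 1%:M).

Lemma apply_if_unitary p V : V \is unitarymx -> apply_if p V \is unitarymx.
Proof.
move=> VV; apply: unitary_blockdiag => k.
by case: (p k); [exact: VV|exact: unitary1].
Qed.

(* As U (reflector target0) U^* is the reflection about U|0,0>, branch k undergoes
   the rotation, its inverse or nothing; over all r < K this adds up to k - K
   rotations. *)
Definition walk_step (r : nat) (A : qalg R w d) : qalg R w d :=
  Apply (apply_if_unitary (forward r) (flagflip_unitary R n.+1))
  (CallDagger finset.setT
  (Apply (apply_if_unitary (fun k => forward r k || backward r k)
           (reflector_unitary sqnorm_target0))
  (Call finset.setT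
  (Apply (apply_if_unitary (backward r) (flagflip_unitary R n.+1)) A)))).

Fixpoint walk (s : nat) (A : qalg R w d) : qalg R w d :=
  if s is r.+1 then walk r (walk_step r A) else A.

(* A call controlled on no label is the identity: [p] of them pad the number of
   calls to a prescribed value. *)
Definition estimation (p : nat) (V F : 'M[C]_w) (VV : V \is unitarymx)
    (FF : F \is unitarymx) (est : 'I_w -> R) : qalg R w d :=
  iter p (Call finset.set0)
    (Apply (unitary_tens VV (unitary1 R d)) (Call finset.setT (walk K
      (Apply (unitary_tens FF (unitary1 R d))
        (Measure (fun q => (mxtens_unindex q).1) (fun y => Output w d (est y))))))).

Lemma calls_walk s A : calls (walk s A) = (s.*2 + calls A)%N.
Proof. by elim: s A => [|s IH] A //=; rewrite IH /=; lia. Qed.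

Lemma calls_estimation p V F (VV : V \is unitarymx) (FF : F \is unitarymx) est :
  calls (estimation p VV FF est) = (p + K.*2.+1)%N.
Proof.
rewrite /estimation; elim: p => [|p IH]; last by rewrite iterS /= IH.
by rewrite /= calls_walk /= big1 // addn0.
Qed.

(** * Output distribution of the algorithm *)

Section Analysis.
Variables (U : 'M[C]_d) (psi0 psi1 : 'cV[C]_n.+1) (E : pred R).
Hypothesis UU : U \is unitarymx.
Hypotheses (psi0_1 : sqnorm psi0 = 1) (psi1_1 : sqnorm psi1 = 1).

(* The algorithm never leaves this real plane. *)
Definition plane (t : R) : 'cV[C]_d :=
  (cos t)%:C *: tensv psi0 (ket R (ord0 : 'I_2))
  + (sin t)%:C *: tensv psi1 (ket R (ord_max : 'I_2)).

Lemma flagflip_plane t : flagflip R n.+1 *m plane t = plane (- t).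
Proof.
rewrite mulmxDr -!scalemxAr !flagflip_tens /= expr0 expr1 scale1r scaleN1r.
by rewrite /plane cosN sinN rmorphN /= scaleNr scalerN.
Qed.

(** The flag makes the two axes orthogonal, whatever the overlap of [psi0] and [psi1]. *)
Lemma ctr_plane s t : (plane s)^t* *m plane t = (cos (s - t))%:C%:M.
Proof.
have ketb (b c : 'I_2) : (ket R b)^t* *m ket R c = ((b == c)%:R : C)%:M.
  by rewrite ctr_ket mxE eqxx andbT.
have p0 : psi0^t* *m psi0 = 1%:M by rewrite -sqnormE psi0_1.
have p1 : psi1^t* *m psi1 = 1%:M by rewrite -sqnormE psi1_1.
have e00 := ctr_tensv p0 (ketb ord0 ord0).
have e11 := ctr_tensv p1 (ketb ord_max ord_max).
have e01 := ctr_tensv (mx11_scalar (psi0^t* *m psi1)) (ketb ord0 ord_max).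
have e10 := ctr_tensv (mx11_scalar (psi1^t* *m psi0)) (ketb ord_max ord0).
rewrite mulr1 in e00; rewrite mulr1 in e11.
by rewrite (ctr_orthonormal_comb _ _ _ _ e00 e11) 1?cosB ?e01 ?e10 ?mulr0 ?raddf0.
Qed.

Lemma reflect_plane s t : reflector (plane s) *m plane t = plane (s *+ 2 - t).
Proof.
rewrite (reflectorE (ctr_plane s t)) /plane scalerDr !scalerA opprD addrACA.
rewrite -!scalerBl -!rmorphMn -!rmorphM -!rmorphB.
have -> : s *+ 2 - t = s + (s - t) by rewrite mulr2n addrA.
congr (_%:C *: _ + _%:C *: _).
  rewrite [in RHS]cosD.
  have -> : cos t = cos (s - (s - t)) by congr cos; rewrite opprB addrCA subrr addr0.
  by rewrite (cosB s (s - t)); ring.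
rewrite [in RHS]sinD.
have -> : sin t = sin (s - (s - t)) by congr sin; rewrite opprB addrCA subrr addr0.
by rewrite (sinB s (s - t)); ring.
Qed.

Variable theta : R.
Hypothesis Utheta : U *m target0 = plane theta.

(** A flag flip before the reflection about [plane theta] sends [t] to [t + 2 theta], a flip after
    it sends [t] to [t - 2 theta], and in an idle branch the two calls cancel. All branches share
    these calls. *)
Lemma prob_walk_step r A (c : 'I_w -> C) (t : 'I_w -> R) :
  prob_output U E (walk_step r A) (joint (fun k => c k *: plane (t k)))
  = prob_output U E A (joint (fun k => c k *:
      plane (t k + theta *+ 2 * ((forward r k)%:R - (backward r k)%:R)))).
Proof.
rewrite /= /apply_if.
rewrite blockdiag_joint controlled_joint blockdiag_joint controlled_joint blockdiag_joint.
congr prob_output; apply: eq_joint => k; rewrite !finset.in_setT -!scalemxAr.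
congr (_ *: _); set S := reflector target0.
have reflU v : U *m (S *m (U^t* *m v)) = reflector (plane theta) *m v.
  by rewrite !mulmxA (conj_reflector _ UU) Utheta.
case fk : (forward r k); case bk : (backward r k) => /=.
- by move: fk bk; rewrite /forward /backward; lia.
- rewrite mul1mx flagflip_plane reflU reflect_plane.
  by congr plane; ring.
- rewrite mul1mx reflU reflect_plane flagflip_plane.
  by congr plane; ring.
rewrite !mul1mx mulmxA (unitarymxP UU) mul1mx.
by congr plane; ring.
Qed.

(** After [s] steps a branch has made all its rotations, or [s] of them if it needs more; hence the
    minima. *)
Lemma prob_walk s A (c : 'I_w -> C) (t : 'I_w -> R) :
  prob_output U E (walk s A) (joint (fun k => c k *: plane (t k)))
  = prob_output U E A (joint (fun k => c k *: plane (t k +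
      theta *+ 2 * ((minn s (k - K))%:R - (minn s (K - k))%:R)))).
Proof.
elim: s A => [|s IH] A.
  apply: (congr1 (prob_output U E A)); apply: eq_joint => k; rewrite !min0n.
  by congr (_ *: plane _); ring.
rewrite [walk _ _]/= IH prob_walk_step.
apply: (congr1 (prob_output U E A)); apply: eq_joint => k.
congr (_ *: plane _); rewrite -addrA -mulrDr; congr (_ + _ * _).
have -> : minn s.+1 (k - K) = (minn s (k - K) + forward s k)%N.
  by rewrite /forward; lia.
have -> : minn s.+1 (K - k) = (minn s (K - k) + backward s k)%N.
  by rewrite /backward; lia.
by rewrite !natrD; ring.
Qed.

(** This is [theta + 2 theta (k - K)], arranged as affine in [k]; the leading [theta] comes from the
    call that prepares [U|0,0>]. *)
Definition branch_angle (k : nat) : R := theta *+ 2 * k%:R + theta * (1 - K.*2%:R).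

Lemma prob_estimation p V F (VV : V \is unitarymx) (FF : F \is unitarymx) est :
  prob_output U E (estimation p VV FF est) (init_state R K.*2 n)
  = \sum_(y | E (est y))
      (sqmod (\sum_k F y k * V k ord0 * (cos (branch_angle k))%:C)
       + sqmod (\sum_k F y k * V k ord0 * (sin (branch_angle k))%:C)).
Proof.
rewrite init_stateE /estimation; elim: p => [|p IH]; last first.
  rewrite iterS /= controlled_joint -IH; congr (prob_output U E _ _).
  apply: eq_joint => k.
  by rewrite finset.in_set0 mul1mx.
rewrite /= tens_joint controlled_joint.
rewrite (@eq_joint _ _ _ _ (fun y => V y ord0 *: plane theta)); last first.
  move=> y; rewrite finset.in_setT -Utheta [RHS]scalemxAr (bigD1 ord0) //= big1 ?addr0.
    by rewrite scale1r.
  by move=> k /negbTE ->; rewrite scale0r scaler0.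
rewrite prob_walk /= tens_joint [RHS]big_mkcond /=; apply: eq_bigr => y _.
case: ifP => // _; rewrite sqnorm_joint_proj.
have -> : \sum_k F y k *: (V k ord0 *: plane (theta +
      theta *+ 2 * ((minn K (k - K))%:R - (minn K (K - k))%:R)))
   = (\sum_k F y k * V k ord0 * (cos (branch_angle k))%:C) *: tensv psi0 (ket R (ord0 : 'I_2))
   + (\sum_k F y k * V k ord0 * (sin (branch_angle k))%:C) *: tensv psi1 (ket R (ord_max : 'I_2)).
  rewrite !scaler_suml -big_split /=; apply: eq_bigr => k _.
  rewrite -!scalerA -!scalerDr; congr (_ *: (_ *: _)).
  have -> : theta + theta *+ 2 * ((minn K (k - K))%:R - (minn K (K - k))%:R)
            = branch_angle k; last by [].
  (* Labels stay within [K] of the centre, so [K] steps complete every branch. *)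
  have lekK : (k <= K.*2)%N by rewrite -ltnS.
  have -> : minn K (k - K) = (k - K)%N by lia.
  have -> : minn K (K - k) = (K - k)%N by lia.
  rewrite natrB_subn /branch_angle.
  have -> : K.*2%:R = K%:R *+ 2 :> R by rewrite -muln2 natrM mulr_natr.
  by ring.
by rewrite sqnorm_tens_flag psi0_1 psi1_1 !mulr1.
Qed.

End Analysis.
End Algorithm.

(** * Fourier transform and Chebyshev window *)

Section Fourier.
Variable R : realType.
Local Notation C := R[i].

Definition cis (x : R) : C := cos x +i* sin x.

Lemma cisD x y : cis (x + y) = cis x * cis y.
Proof. by apply/eqP; rewrite eq_complex /= cosD sinD; apply/andP; split=> //; apply/eqP; ring. Qed.

Lemma cis0 : cis 0 = 1.
Proof. by rewrite /cis cos0 sin0. Qed.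

Lemma cisMn (n : nat) x : cis (x * n%:R) = cis x ^+ n.
Proof.
elim: n => [|n IH]; first by rewrite mulr0 cis0.
by rewrite exprSr -IH -cisD -[n.+1]addn1 natrD mulrDr mulr1.
Qed.

Lemma sqmod_cis x : sqmod (cis x) = 1.
Proof. exact: cos2Dsin2. Qed.

Lemma conj_cis x : (cis x)^* = cis (- x).
Proof. by rewrite /cis cosN sinN. Qed.

Lemma cis_2pi_nat (n : nat) : cis (pi * 2 * n%:R) = 1.
Proof. by rewrite cisMn mulr_natr /cis cos2pi sin2pi expr1n. Qed.

Lemma cis_eq1 x : 0 < x < 2 * pi -> cis x != 1.
Proof.
move=> /andP[x0 x2pi]; rewrite eq_complex /= negb_and; apply/orP; left.
have -> : x = (x / 2) *+ 2 by rewrite -mulr_natr divfK.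
have s0 : 0 < sin (x / 2) by rewrite sin_gt0_pi //; apply/andP; split; lra.
by rewrite cos_mulr2n cos2sin2; apply/eqP; nra.
Qed.

Variable w : nat.
Local Notation L := w.+1.

Definition grid (y : 'I_L) : R := pi * 2 * y%:R / L%:R.

Lemma grid_neq (y z : 'I_L) : y != z -> cis (grid y - grid z) != 1.
Proof.
have cis1 (u v : 'I_L) : (u < v)%N -> cis (grid v - grid u) != 1.
  move=> uv; apply: cis_eq1; rewrite /grid -mulrBl -mulrBr.
  have v1 : (v%:R : R) < L%:R by rewrite ltr_nat.
  have u0 : (0 : R) <= u%:R by [].
  have uvR : (u%:R : R) < v%:R by rewrite ltr_nat.
  have p0 := pi_gt0 R.
  rewrite divr_gt0 ?ltr0n // ?ltr_pdivrMr ?ltr0n //=.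
    by rewrite [2 * pi]mulrC ltr_pM2l ?mulr_gt0 //; lra.
  by rewrite !mulr_gt0 // subr_gt0.
rewrite neq_ltn => /orP[yz|]; last exact: cis1.
apply/eqP => h; have /eqP := cis1 _ _ yz; apply.
by rewrite -opprB -conj_cis h conjc1.
Qed.

Lemma grid_pow (y : 'I_L) : cis (grid y) ^+ L = 1.
Proof. by rewrite -cisMn /grid divfK ?pnatr_eq0 // cis_2pi_nat. Qed.

Lemma gridN_pow (y : 'I_L) : cis (- grid y) ^+ L = 1.
Proof.
by rewrite -[LHS]mul1r -{1}(grid_pow y) -exprMn -cisD subrr cis0 expr1n.
Qed.

Definition fourier : 'M[C]_L :=
  \matrix_(y, k) ((Num.sqrt L%:R)^-1%:C * cis (- grid y) ^+ k).

Lemma fourier_unitary : fourier \is unitarymx.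
Proof.
apply/unitarymxP/matrixP => y z; rewrite !mxE.
have rr : (Num.sqrt L%:R)^-1 * (Num.sqrt L%:R)^-1 = L%:R^-1 :> R.
  by rewrite -invfM -expr2 sqr_sqrtr.
transitivity (L%:R^-1%:C * \sum_(k < L) cis (grid z - grid y) ^+ k).
  rewrite mulr_sumr; apply: eq_bigr => k _; rewrite !mxE rmorphM rmorphXn /=.
  rewrite [_^*%R]conjc_real [_^*%R]conj_cis opprK mulrACA -rmorphM rr.
  by rewrite -exprMn -cisD addrC.
have [->|yz] := eqVneq y z.
  rewrite subrr cis0; under eq_bigr do rewrite expr1n.
  rewrite sumr_const card_ord; have -> : (1 : C) *+ L = (L%:R : R)%:C by rewrite rmorph_nat.
  by rewrite -rmorphM mulVf ?pnatr_eq0.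
(* Geometric sum of a nontrivial [L]-th root of unity. *)
have := subrX1 (cis (grid z - grid y)) L.
rewrite {1}cisD exprMn grid_pow gridN_pow mul1r subrr.
move=> /esym/eqP; rewrite mulf_eq0 => /orP[|/eqP ->].
  by rewrite subr_eq0 (negbTE (grid_neq _)) // eq_sym.
by rewrite mulr0.
Qed.

(** Up to the factor [Num.sqrt L], these sums are the Fourier transform of [m] unit-modulus entries
    padded with zeros to length [L], and [fourier] preserves the norm. *)
Lemma dirichlet_parseval (phi : R) (m : nat) : (m <= L)%N ->
  \sum_(y < L) sqmod (\sum_(j < m) cis (phi - grid y) ^+ j) = L%:R * m%:R.
Proof.
move=> mL; pose v : 'cV[C]_L := \col_j (if (j < m)%N then cis phi ^+ j else 0).
have vm : sqnorm v = m%:R.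
  transitivity (\sum_(j < L) (if (j < m)%N then 1 else 0 : R)).
    apply: eq_bigr => j _; rewrite mxE; case: ifP => _; last by rewrite /= expr0n addr0.
    rewrite -cisMn; exact: sqmod_cis.
  rewrite -big_mkcond /= (big_ord_narrow mL) /= sumr_const card_ord.
  by [].
rewrite -vm -(sqnorm_unitary _ fourier_unitary) mulr_sumr; apply: eq_bigr => y _.
rewrite -[_ ^+ 2 + _]/(sqmod _) -(@sqr_sqrtr _ L%:R) // -sqmod_real -sqmodM mxE.
congr sqmod; rewrite (big_ord_widen L (fun j : nat => cis (phi - grid y) ^+ j) mL).
rewrite big_mkcond mulr_sumr /=.
apply: eq_bigr => j _; rewrite !mxE; case: ifP => _; last by rewrite !mulr0.
rewrite !mulrA -rmorphM mulfV ?sqrtr_eq0 -?ltNge ?ltr0n // mul1r -exprMn -cisD.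
by rewrite addrC.
Qed.

End Fourier.

(** * Chebyshev polynomials *)

Section Chebyshev.
Variable R : realType.
Local Notation C := R[i].

Fixpoint chebyshev (u : R) (n : nat) : R :=
  if n is n'.+1 then
    if n' is n''.+1 then 2 * u * chebyshev u n' - chebyshev u n'' else u
  else 1.

Lemma chebyshevSS u n :
  chebyshev u n.+2 = 2 * u * chebyshev u n.+1 - chebyshev u n.
Proof. by []. Qed.

Lemma nat_ind2 (P : nat -> Prop) :
  P 0%N -> P 1%N -> (forall n, P n -> P n.+1 -> P n.+2) -> forall n, P n.
Proof.
move=> P0 P1 PSS n; suff [] : P n /\ P n.+1 by [].
by elim: n => [//|n [Pn PSn]]; split => //; exact: PSS.
Qed.

Lemma chebyshev_cos s n : chebyshev (cos s) n = cos (s * n%:R).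
Proof.
elim/nat_ind2: n => [||n IH0 IH1]; first by rewrite mulr0 cos0.
  by rewrite mulr1.
rewrite chebyshevSS IH0 IH1.
have -> : s * n.+2%:R = s * n.+1%:R + s by rewrite -[n.+2]addn1 natrD; ring.
have -> : s * n%:R = s * n.+1%:R - s by rewrite -[n.+1]addn1 natrD; ring.
by rewrite cosB cosD; ring.
Qed.

Lemma chebyshev_le1 u n : `|u| <= 1 -> `|chebyshev u n| <= 1.
Proof.
move=> u1; have u_itv : u \in `[(-1), 1] by rewrite in_itv /= -ler_norml.
by rewrite -(acosK u_itv) chebyshev_cos cos_max.
Qed.

(** At [(z + z^-1) / 2] the recursion solves to [(z ^+ n + z^-1 ^+ n) / 2], and the second power is
    nonnegative. *)
Lemma chebyshev_ge z n : 0 < z -> z ^+ n / 2 <= chebyshev ((z + z^-1) / 2) n.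
Proof.
move=> z0; have zV : z * z^-1 = 1 by rewrite mulfV ?gt_eqF.
have -> : chebyshev ((z + z^-1) / 2) n = (z ^+ n + z^-1 ^+ n) / 2.
  elim/nat_ind2: n => [||n IH0 IH1]; [by rewrite !expr0 /=; field|by rewrite !expr1|].
  rewrite chebyshevSS IH0 IH1 !exprS; move: z^-1 zV => y zV.
  have -> : 2 * ((z + y) / 2) * ((z * z ^+ n + y * y ^+ n) / 2) - (z ^+ n + y ^+ n) / 2
     = (z * (z * z ^+ n) + y * (y * y ^+ n)) / 2 + (z * y - 1) * (z ^+ n + y ^+ n) / 2
    by field.
  by rewrite zV subrr !mul0r addr0.
by rewrite ler_pM2r // lerDl exprn_ge0 // invr_ge0 ltW.
Qed.

(* [chebyshev_window b n] evaluated at [e^(2ix)] is [e^(inx) T_n(b cos x)]. *)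
Fixpoint chebyshev_window (b : R) (n : nat) : {poly R} :=
  if n is n'.+1 then
    if n' is n''.+1 then
      b *: ((1 + 'X) * chebyshev_window b n') - 'X * chebyshev_window b n''
    else (b / 2) *: (1 + 'X)
  else 1.

Lemma size_chebyshev_window b n : (size (chebyshev_window b n) <= n.+1)%N.
Proof.
have size1X : (size (1 + 'X : {poly R})%R <= 2)%N.
  by rewrite (leq_trans (size_polyD _ _)) // geq_max size_poly1 size_polyX.
elim/nat_ind2: n => [||n IH0 IH1]; first by rewrite size_poly1.
  by rewrite (leq_trans (size_scale_leq _ _)).
rewrite /= (leq_trans (size_polyD _ _)) // geq_max size_polyN.
apply/andP; split.
  rewrite (leq_trans (size_scale_leq _ _)) // (leq_trans (size_polyMleq _ _)) //.
  by rewrite -subn1 leq_subLR (leq_trans (leq_add size1X IH1)).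
rewrite (leq_trans (size_polyMleq _ _)) // size_polyX /=.
exact: leqW IH0.
Qed.

Lemma chebyshev_windowE b n x :
  (map_poly (real_complex R) (chebyshev_window b n)).[cis (x *+ 2)]
  = cis x ^+ n * (chebyshev (b * cos x) n)%:C.
Proof.
(* This factorisation turns the recursion of the window into the Chebyshev recursion at
   [b * cos x]. *)
have e2 : 1 + cis (x *+ 2) = 2 * cis x * (cos x)%:C.
  apply/eqP; rewrite eq_complex /= cos_mulr2n sin_mulr2n.
  by apply/andP; split; apply/eqP; ring.
have cis2 : cis (x *+ 2) = cis x * cis x by rewrite mulr2n cisD.
elim/nat_ind2: n => [||n IH0 IH1].
- by rewrite /= rmorph1 hornerC expr0 mul1r.
- rewrite /= linearZ /= rmorphD rmorph1 /= map_polyX hornerE !(hornerD, hornerX, hornerC).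
  by rewrite e2 !rmorphM fmorphV /= rmorph_nat expr1; field.
rewrite chebyshevSS [chebyshev_window _ _]/= rmorphB /= linearZ /=.
rewrite !rmorphM rmorphD rmorph1 /= map_polyX.
rewrite hornerD hornerN hornerZ !hornerM hornerD hornerX hornerC IH0 IH1.
rewrite e2 cis2 !exprS rmorphB !rmorphM rmorph_nat /=; ring.
Qed.

End Chebyshev.

(** Cauchy-Schwarz against the constant vector, read off from the sum of squared deviations from the
    mean. *)
Lemma sqr_sum_le (R : realFieldType) n (f : 'I_n -> R) :
  (\sum_i f i) ^+ 2 <= n%:R * \sum_i f i ^+ 2.
Proof.
case: n f => [|n] f; first by rewrite !big_ord0 mul0r expr0n.
set s := \sum_i f i; set q := \sum_i f i ^+ 2.
have : 0 <= \sum_i (n.+1%:R * f i - s) ^+ 2 by apply: sumr_ge0 => i _; exact: sqr_ge0.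
have -> : \sum_i (n.+1%:R * f i - s) ^+ 2 = n.+1%:R * (n.+1%:R * q - s ^+ 2).
  transitivity (\sum_i (n.+1%:R ^+ 2 * f i ^+ 2 - 2 * n.+1%:R * s * f i + s ^+ 2)).
    by apply: eq_bigr => i _; ring.
  rewrite big_split sumrB /= sumr_const card_ord -!mulr_sumr -/s -/q.
  by rewrite -[s ^+ 2 *+ _]mulr_natl; ring.
by rewrite pmulr_rge0 ?ltr0n // subr_ge0.
Qed.

(** Both cosines are at most the scalar product of the unit vectors [(|cos v|, |sin v|)] and
    [(|cos u|, |sin u|)], that is 1 minus half their squared distance; their first coordinates
    already differ by more than [eps]. *)
Lemma cos_separation (R : realType) (u v eps : R) : 0 <= cos v -> 0 < eps ->
  eps < `| `|cos u| - cos v| ->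
  `|cos (v - u)| <= 1 - eps ^+ 2 / 2 /\ `|cos (- v - u)| <= 1 - eps ^+ 2 / 2.
Proof.
move=> v0 e0 euv; rewrite -opprD cosN cosB cosD.
have sum_le (p q s t : R) : p ^+ 2 + s ^+ 2 = 1 -> q ^+ 2 + t ^+ 2 = 1 ->
    eps ^+ 2 <= (p - q) ^+ 2 -> q * p + t * s <= 1 - eps ^+ 2 / 2.
  by move=> ps qt epq; have := sqr_ge0 (s - t); nra.
have : `|cos v| * `|cos u| + `|sin v| * `|sin u| <= 1 - eps ^+ 2 / 2.
  apply: sum_le; rewrite ?real_normK ?num_real ?cos2Dsin2 //.
  rewrite (ger0_norm v0) -[leRHS]real_normK ?num_real // ler_pXn2r ?nnegrE ?(ltW e0) //.
  exact: ltW.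
move=> h; split; apply: le_trans h; rewrite -!normrM.
  exact: ler_normD.
exact: ler_normB.
Qed.

(** * The window polynomial *)

Section Window.
Variables (R : realType) (b : R) (M m : nat).
Local Notation C := R[i].

Definition window : {poly R} := chebyshev_window b M * \sum_(j < m) 'X^j.

Lemma size_window : (0 < m)%N -> (size window <= M + m)%N.
Proof.
move=> m0; rewrite (leq_trans (size_polyMleq _ _)) //.
have sD : (size (\sum_(j < m) 'X^j : {poly R})%R <= m)%N.
  apply: (leq_trans (size_sum _ _ _)); apply/bigmax_leqP => j _.
  by rewrite size_polyXn.
by have := size_chebyshev_window b M; lia.
Qed.

Lemma sqmodX (z : C) n : sqmod (z ^+ n) = sqmod z ^+ n.
Proof.
elim: n => [|n IH]; first by rewrite !expr0 sqmod_real expr1n.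
by rewrite !exprS sqmodM IH.
Qed.

Lemma sqmod_window x :
  sqmod (map_poly (real_complex R) window).[cis (x *+ 2)]
  = chebyshev (b * cos x) M ^+ 2 * sqmod (\sum_(j < m) cis (x *+ 2) ^+ j).
Proof.
rewrite rmorphM hornerM chebyshev_windowE !sqmodM sqmodX sqmod_cis expr1n mul1r.
rewrite sqmod_real; congr (_ * sqmod _); rewrite rmorph_sum horner_sum /=.
by apply: eq_bigr => j _; rewrite map_polyXn hornerXn.
Qed.

Lemma window1 : window.[1] = chebyshev b M * m%:R.
Proof.
rewrite hornerM horner_sum; congr (_ * _); last first.
  under eq_bigr do rewrite hornerXn expr1n.
  by rewrite sumr_const card_ord.
apply: (@complexI R); have := chebyshev_windowE b M 0.
by rewrite mul0rn cis0 expr1n mul1r cos0 mulr1 -(rmorph1 (real_complex R)) horner_map.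
Qed.

End Window.

(** * Failure probability for a given window *)

Section ErrorBound.
Variables (R : realType) (b eps : R) (M m K : nat).
Local Notation C := R[i].
Local Notation L := (K.*2).+1.
Hypotheses (m_gt0 : (0 < m)%N) (sizeML : (M + m <= L)%N).
Hypotheses (eps_gt0 : 0 < eps) (b_ge0 : 0 <= b) (b_le : b * (1 - eps ^+ 2 / 2) <= 1).
Hypothesis cheb_gt0 : 0 < chebyshev b M.

Let W := window b M m.
Let S := \sum_(k < L) W`_k ^+ 2.

(** The value of the window at 1 is the sum of its at most [L] coefficients; apply
    Cauchy-Schwarz. *)
Lemma window_energy_ge : (chebyshev b M * m%:R) ^+ 2 / L%:R <= S.
Proof.
rewrite ler_pdivrMr ?ltr0n // [leRHS]mulrC -window1.
rewrite (horner_coef_wide _ (leq_trans (size_window b M m_gt0) sizeML)).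
under eq_bigr do rewrite expr1n mulr1.
exact: sqr_sum_le.
Qed.

Lemma window_energy_gt0 : 0 < S.
Proof.
apply: lt_le_trans window_energy_ge.
by rewrite divr_gt0 ?exprn_gt0 ?mulr_gt0 ?ltr0n.
Qed.

Lemma exists_window_state : exists2 V : 'M[C]_L, V \is unitarymx &
  forall k, V k ord0 = (W`_k / Num.sqrt S)%:C.
Proof.
pose v : 'cV[C]_L := \col_k (W`_k / Num.sqrt S)%:C.
have v1 : sqnorm v = 1.
  rewrite /sqnorm; under eq_bigr do rewrite mxE -/(sqmod _) sqmod_real exprMn exprVn.
  rewrite -mulr_suml sqr_sqrtr ?ltW ?window_energy_gt0 //.
  by rewrite mulfV // gt_eqF // window_energy_gt0.
(* The amplitudes are real, so the imaginary part of the first one vanishes by computation. *)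
have [V VV Vv] := exists_unitary_col v1 (congr1 _ (mxE _ _ _ _)).
exists V => // k; have /matrixP/(_ k ord0) := Vv; rewrite !mxE => <-.
rewrite (bigD1 ord0) //= big1 ?addr0 => [|l /negbTE l0].
  by rewrite !mxE !eqxx mulr1.
by rewrite mxE l0 mulr0.
Qed.

(** Passing to the eigenbasis of the rotation splits the outcome probability into the average of two
    phase estimations, with opposite phases. *)
Lemma sqmod_cos_sin (X : 'I_L -> C) (t : 'I_L -> R) :
  sqmod (\sum_k X k * (cos (t k))%:C) + sqmod (\sum_k X k * (sin (t k))%:C)
  = (sqmod (\sum_k X k * cis (t k)) + sqmod (\sum_k X k * cis (- t k))) / 2.
Proof.
rewrite sqmodDi; congr ((sqmod _ + sqmod _) / 2).
  rewrite mulr_sumr -big_split /=; apply: eq_bigr => k _.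
  by rewrite mulrCA -mulrDr; congr (_ * _); rewrite [RHS]complexE.
rewrite mulr_sumr -sumrB /=; apply: eq_bigr => k _.
rewrite mulrCA -mulrBr; congr (_ * _); rewrite [RHS]complexE /= cosN sinN.
by rewrite rmorphN mulrN.
Qed.

(** The offset [c] is a global phase, and the remaining sum is the normalised window evaluated on
    the unit circle. *)
Lemma sqmod_amplitude (V : 'M[C]_L) (y : 'I_L) (phi c : R) :
  (forall k, V k ord0 = (W`_k / Num.sqrt S)%:C) ->
  sqmod (\sum_k fourier R K.*2 y k * V k ord0 * cis (phi *+ 2 * k%:R + c))
  = (L%:R * S)^-1 * chebyshev (b * cos (phi - grid R y / 2)) M ^+ 2
    * sqmod (\sum_(j < m) cis (phi *+ 2 - grid R y) ^+ j).
Proof.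
move=> VW; have gE : (phi - grid R y / 2) *+ 2 = phi *+ 2 - grid R y.
  by rewrite mulrnBl -[(_ / 2) *+ 2]mulr_natr divfK.
rewrite -mulrA -gE -sqmod_window gE.
rewrite (horner_coef_wide (n := L)); last first.
  by rewrite size_map_poly (leq_trans (size_window b M m_gt0) sizeML).
have -> : (L%:R * S)^-1 = sqmod ((Num.sqrt L%:R)^-1 * (Num.sqrt S)^-1)%:C.
  by rewrite sqmod_real -invfM exprVn exprMn !sqr_sqrtr // ltW // window_energy_gt0.
rewrite -sqmodM -[RHS]mul1r -[X in _ = X * _](sqmod_cis c) -sqmodM; congr sqmod.
rewrite !mulr_sumr; apply: eq_bigr => k _; rewrite VW mxE coef_map /=.
by rewrite cisD cisMn [in RHS]cisD exprMn !rmorphM /= -/W; ring.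
Qed.

(** [V] is chosen before [theta], since the algorithm may not depend on the unknown unitary. *)
Lemma tail_probability : exists2 V : 'M[C]_L, V \is unitarymx &
  forall theta : R, 0 <= cos theta ->
  \sum_(y < L | eps < `| `|cos (grid R y / 2)| - cos theta|)
    (sqmod (\sum_k fourier R K.*2 y k * V k ord0 * (cos (branch_angle K theta k))%:C)
     + sqmod (\sum_k fourier R K.*2 y k * V k ord0 * (sin (branch_angle K theta k))%:C))
  <= L%:R / (m%:R * chebyshev b M ^+ 2).
Proof.
have [V VV VW] := exists_window_state; exists V => // theta theta0.
pose D (phi : R) (y : 'I_L) := sqmod (\sum_(j < m) cis (phi - grid R y) ^+ j).
have S0 := window_energy_gt0.
have L0 : 0 < L%:R :> R by rewrite ltr0n.
have mL : (m <= L)%N by apply: leq_trans sizeML; rewrite leq_addl.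
(* On the tail the Chebyshev factor is at most 1; once it is dropped, the sum may run over all [y],
   where Parseval applies. *)
apply: (@le_trans _ _ (\sum_(y < L)
   (L%:R * S)^-1 * ((D (theta *+ 2) y + D ((- theta) *+ 2) y) / 2))).
  rewrite [leLHS]big_mkcond /=; apply: ler_sum => y _.
  have DD0 phi : 0 <= D phi y by exact: sqmod_ge0.
  have LS0 : 0 < (L%:R * S)^-1 by rewrite invr_gt0 mulr_gt0.
  case: ifP => [tail|_]; last first.
    by rewrite mulr_ge0 ?(ltW LS0) // divr_ge0 // addr_ge0.
  have [cosB_le cosD_le] := cos_separation theta0 eps_gt0 tail.
  have cheb1 x : `|cos x| <= 1 - eps ^+ 2 / 2 -> chebyshev (b * cos x) M ^+ 2 <= 1.
    move=> cx; rewrite -[_ ^+ 2]real_normK ?num_real // expr_le1 //.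
    apply: chebyshev_le1; rewrite normrM (ger0_norm b_ge0).
    by apply: le_trans b_le; rewrite ler_wpM2l.
  rewrite sqmod_cos_sin.
  have -> : \sum_k fourier R K.*2 y k * V k ord0 * cis (- branch_angle K theta k)
    = \sum_k fourier R K.*2 y k * V k ord0
       * cis ((- theta) *+ 2 * k%:R - theta * (1 - K.*2%:R)).
    by apply: eq_bigr => k _; congr (_ * cis _); rewrite /branch_angle opprD mulNrn mulNr.
  rewrite !sqmod_amplitude // -!/(D _ _) -!(mulrA (L%:R * S)^-1) -mulrDr.
  rewrite -(mulrA (L%:R * S)^-1) ler_pM2l // ler_pM2r //.
  by apply: lerD; rewrite ler_piMl // cheb1.
rewrite -mulr_sumr -mulr_suml big_split /= !dirichlet_parseval //.
have -> : (L%:R * S)^-1 * ((L%:R * m%:R + L%:R * m%:R) / 2) = m%:R / S.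
  by field; rewrite !gt_eqF.
have m0 : 0 < m%:R :> R by rewrite ltr0n.
have := window_energy_ge; rewrite ler_pdivrMr // => energy.
rewrite ler_pdivrMr // -mulrA mulrC -mulrA ler_pdivlMl ?mulr_gt0 ?exprn_gt0 //.
by move: energy; rewrite exprMn; nra.
Qed.

End ErrorBound.

(** * Choice of the parameters *)

Section Tuning.
Variable R : realType.

(** The difference [g] of the two sides after clearing denominators vanishes at 0 and has derivative
    [x * (expR x - expR (- x))], nonnegative for [x >= 0]. *)
Lemma expR_le_moebius (h : R) : 0 <= h < 1 -> expR (2 * h) <= (1 + h) / (1 - h).
Proof.
move=> /andP[h0 h1]; pose g (x : R) := (1 + x) * expR (- x) - (1 - x) * expR x.
have dg (x : R) : is_derive x 1 g (x * (expR x - expR (- x))).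
  by rewrite /g; apply: is_derive_eq; rewrite /GRing.scale /=; ring.
have : g 0 <= g h.
  apply: (@ger0_derive1_ndecry R g 0) => // [x|].
    rewrite in_itv /= andbT => x0; rewrite derive1E (@derive_val _ _ _ _ _ _ _ (dg x)).
    by rewrite mulr_ge0 ?(ltW x0) // subr_ge0 ler_expR; lra.
  by apply: derivable_within_continuous => x _; exact: (@ex_derive _ _ _ _ _ _ _ (dg x)).
rewrite /g oppr0 subrr subr_ge0 => gh.
rewrite ler_pdivlMr ?subr_gt0 // mulrC.
have -> : 2 * h = h + h by ring.
rewrite expRD mulrA -ler_pdivlMr ?expR_gt0 //.
by rewrite -expRN.
Qed.

(* The failure probability is at most 32 e^4 (1 + alpha) e^(- 2 pi alpha), and
   [32 * expR 4 < kappa] makes this smaller than e^(-l). *)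
Definition kappa : R := 32 * expR 4 + 2.

(** Here [l] is [ln delta^-1]. Then [expR (2 * pi * alpha)] equals [expR l * (kappa + l) ^+ 2]: one
    factor [kappa + l] pays for [1 + alpha], the other for the constants. *)
Definition window_parameter (l : R) : R := (l + 2 * ln (kappa + l)) / (2 * pi).

Lemma kappa_ge34 : 34 <= kappa.
Proof. by have : 1 <= expR 4 :> R by [rewrite -expR0 ler_expR]; rewrite /kappa; lra. Qed.

Lemma pi_lt4 : pi < 4 :> R.
Proof. by have := pihalf_lt2 R; lra. Qed.

Lemma ln_kappa_gt4 l : 0 <= l -> 4 < ln (kappa + l).
Proof.
move=> l0; have e4 : expR 4 < kappa + l.
  by have := expR_gt0 (4 : R); rewrite /kappa; lra.
rewrite -[ltLHS]expRK ltr_ln ?posrE ?expR_gt0 //.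
by apply: lt_trans e4; exact: expR_gt0.
Qed.

Lemma window_parameter_gt0 l : 0 <= l -> 0 < window_parameter l.
Proof.
move=> l0; have := ln_kappa_gt4 l0; have := pi_gt0 R => p0 k4.
by rewrite divr_gt0 ?mulr_gt0 //; lra.
Qed.

Lemma window_parameter_le l : 0 <= l -> 1 + window_parameter l <= kappa + l.
Proof.
move=> l0; have k34 := kappa_ge34; have k4 := ln_kappa_gt4 l0.
have ln_lt : ln (kappa + l) < kappa + l by apply: ln_sublinear; lra.
have p2 := pi_ge2 R; rewrite /window_parameter.
suff : (l + 2 * ln (kappa + l)) / (2 * pi) <= (l + 2 * ln (kappa + l)) / 4 by lra.
by rewrite ler_pM2l ?lef_pV2 ?posrE; lra.
Qed.

Lemma window_parameter_asymp l : kappa <= l ->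
  0 <= pi * window_parameter l - l / 2 <= 2 * ln l.
Proof.
move=> kl; have k34 := kappa_ge34; have p0 := pi_gt0 R.
have -> : pi * window_parameter l - l / 2 = ln (kappa + l).
  rewrite /window_parameter; move: (@pi R) p0 => q q0.
  by field; rewrite gt_eqF.
have l0 : 0 <= l by lra.
have := ln_kappa_gt4 l0 => k4.
have : ln (kappa + l) <= ln (l ^+ 2).
  have kl2 : kappa + l <= l ^+ 2 by nra.
  by rewrite ler_ln // posrE; nra.
rewrite lnXn; last by lra.
by rewrite -mulr_natl => lnl; apply/andP; split => //; lra.
Qed.

Lemma sqrt1D_bounds (x : R) : 0 <= x ->
  x <= Num.sqrt (1 + x ^+ 2) <= 1 + x.
Proof.
move=> x0; apply/andP; split.
  by rewrite -[leLHS]ger0_norm // -sqrtr_sqr ler_wsqrtr // lerDr.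
rewrite -[leRHS]ger0_norm ?addr_ge0 // -sqrtr_sqr ler_wsqrtr //; nra.
Qed.

End Tuning.

(** The walk makes an odd number of calls, so an even [N] needs one padding call; this is the 1 lost
    in the last bound. *)
Lemma odd_workspace N m : (m + 3 <= N)%N -> exists K p M,
  [/\ N = (p + K.*2.+1)%N, (M + m <= K.*2.+1)%N & (N <= M + m + 1)%N].
Proof.
move=> mN; exists (N.-1)./2, (N - ((N.-1)./2).*2.+1)%N, (((N.-1)./2).*2.+1 - m)%N.
by split; lia.
Qed.

(** * Assembling the algorithm *)

Section Final.
Variable R : realType.

(** The argument is [(z + z^-1) / 2] for [z = (1 + h) / (1 - h)], and [z >= expR (2 * h)]. *)
Lemma chebyshev_moebius_ge (h : R) M : 0 <= h < 1 ->
  expR (2 * h * M%:R) / 2 <= chebyshev ((1 + h ^+ 2) / (1 - h ^+ 2)) M.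
Proof.
move=> h01; have /andP[h0 h1] := h01.
have z0 : 0 < (1 + h) / (1 - h) by rewrite divr_gt0; lra.
have -> : (1 + h ^+ 2) / (1 - h ^+ 2) = ((1 + h) / (1 - h) + ((1 + h) / (1 - h))^-1) / 2.
  by field; apply/and3P; split; apply/eqP; nra.
apply: le_trans (chebyshev_ge _ z0); rewrite ler_pM2r // expRM_natr.
by rewrite lerXn2r ?nnegrE ?expR_ge0 ?(ltW z0) // expR_le_moebius.
Qed.

Lemma tail_probability_lt (l eps q : R) (L M m : nat) :
  0 <= l -> 0 < eps < 1 / 2 ->
  L%:R <= q -> q * eps <= pi * (1 + window_parameter l) ->
  1 <= 2 * eps * m%:R -> pi * window_parameter l - 2 <= eps * M%:R ->
  L%:R / (m%:R * chebyshev ((1 + (eps / 2) ^+ 2) / (1 - (eps / 2) ^+ 2)) M ^+ 2)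
  < expR (- l).
Proof.
move=> l0 /andP[e0 e2] Lq qeps meps Meps.
set T := chebyshev _ _; pose X := pi * window_parameter l.
have k34 := kappa_ge34 R.
have XE : expR (2 * X) = expR l * (kappa R + l) ^+ 2.
  have -> : 2 * X = l + 2 * ln (kappa R + l).
    rewrite /X /window_parameter; move: (@pi R) (pi_gt0 R) => r r0.
    by field; rewrite gt_eqF.
  rewrite expRD; congr (_ * _).
  have -> : 2 * ln (kappa R + l) = ln (kappa R + l) + ln (kappa R + l) by ring.
  by rewrite expRD lnK ?posrE //; lra.
have TX : expR (X - 2) / 2 <= T.
  have e01 : 0 <= eps / 2 < 1 by lra.
  apply: le_trans (chebyshev_moebius_ge M e01); rewrite ler_pM2r // ler_expR.
  by have -> : 2 * (eps / 2) = eps by field.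
have T2 : expR (2 * X) / (4 * expR 4) <= T ^+ 2.
  have -> : expR (2 * X) / (4 * expR 4) = (expR (X - 2) / 2) ^+ 2.
    have -> : 2 * X = (X - 2) + (X - 2) + 4 by ring.
    by rewrite !expRD; field; rewrite gt_eqF ?expR_gt0.
  by rewrite ler_pXn2r ?nnegrE // ?divr_ge0 ?expR_ge0 // (le_trans _ TX) // divr_ge0 ?expR_ge0.
have m0 : 0 < m%:R :> R.
  by rewrite ltr0n lt0n; apply/eqP => m0; move: meps; rewrite m0 mulr0; lra.
have T0 : 0 < T ^+ 2.
  by apply: lt_le_trans T2; rewrite divr_gt0 ?expR_gt0 // mulr_gt0 ?expR_gt0.
rewrite ltr_pdivrMr ?(mulr_gt0 m0 T0) //.
have k0 : 0 < kappa R + l by lra.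
have E40 := expR_gt0 (4 : R).
have El : expR (- l) * expR l = 1 by rewrite mulrC expRxMexpNx_1.
(* [L * eps] is at most [4 * (kappa + l)] because [pi < 4]; the second factor [kappa + l] exceeds
   the remaining constant [32 * expR 4]. *)
have key : L%:R * eps * 2 < expR (- l) * T ^+ 2.
  apply: (@lt_le_trans _ _ ((kappa R + l) ^+ 2 / (4 * expR 4))); last first.
    have -> : (kappa R + l) ^+ 2 / (4 * expR 4) = expR (- l) * (expR (2 * X) / (4 * expR 4)).
      by rewrite XE !mulrA El mul1r.
    by rewrite ler_pM2l ?expR_gt0.
  rewrite ltr_pdivlMr ?mulr_gt0 //.
  have Lb : L%:R * eps <= 4 * (kappa R + l).
    have a1 := window_parameter_le l0; have a0 := window_parameter_gt0 l0.
    apply: (@le_trans _ _ (q * eps)); first by rewrite ler_pM2r.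
    apply: (le_trans qeps); apply: ler_pM; rewrite ?pi_ge0 ?(ltW (pi_lt4 R)) //; lra.
  have kl : 32 * expR 4 < kappa R + l by rewrite /kappa; lra.
  by nra.
have L0 : 0 <= L%:R :> R by [].
have D0 := expR_gt0 (- l).
have : L%:R <= L%:R * eps * 2 * m%:R by nra.
have : 0 < (expR (- l) * T ^+ 2 - L%:R * eps * 2) * m%:R by rewrite mulr_gt0 // subr_gt0.
by lra.
Qed.

Lemma exists_estimation (l eps : R) (n N : nat) :
  0 <= l -> 0 < eps < 1 / 2 ->
  N = Num.truncn (query_bound (window_parameter l) eps) ->
  exists (w : nat) (A : qalg R w.+1 (n.+1 * 2)), calls A = N /\
    forall (U : 'M[R[i]]_(n.+1 * 2)) (a : R) (psi0 psi1 : 'cV[R[i]]_n.+1),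
      U \is unitarymx -> 0 < a < 1 -> sqnorm psi0 = 1 -> sqnorm psi1 = 1 ->
      prepares U a psi0 psi1 ->
      prob_output U (fun ahat => eps < `|ahat - a|) A (init_state R w n) < expR (- l).
Proof.
move=> l0 e01 NE; have /andP[e0 e2] := e01.
set q := query_bound _ _ in NE.
have al0 := window_parameter_gt0 l0.
have p0 := pi_gt0 R.
have [qlo qhi] : pi * window_parameter l <= q * eps
    /\ q * eps <= pi * (1 + window_parameter l).
  have /andP[s1 s2] := sqrt1D_bounds (ltW al0).
  have -> : q * eps = pi * Num.sqrt (1 + window_parameter l ^+ 2).
    rewrite /q /query_bound; move: (@pi R) => r; by field; rewrite gt_eqF.
  by rewrite !ler_pM2l.
have X4 : 4 < pi * window_parameter l.
  have k4 := ln_kappa_gt4 l0.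
  have -> : pi * window_parameter l = l / 2 + ln (kappa R + l).
    rewrite /window_parameter; move: (@pi R) p0 => r r0; by field; rewrite gt_eqF.
  by lra.
have q0 : 0 < q by rewrite -(pmulr_lgt0 _ e0); lra.
have /andP[Nq qN] := truncn_itv (ltW q0); rewrite -NE in Nq qN.
have ie0 : 0 < eps^-1 by rewrite invr_gt0.
have iee : eps^-1 * eps = 1 by rewrite mulVf // gt_eqF.
(* Since [eps < 1 / 2], rounding down keeps [m * eps] between 1/2 and 1: the Dirichlet factor takes
   only a bounded part of [N * eps]. *)
pose m := Num.truncn eps^-1.
have /andP[mlo mhi] := truncn_itv (ltW ie0); rewrite -/m in mlo mhi.
rewrite -[m.+1]addn1 natrD in mhi; rewrite -[N.+1]addn1 natrD in qN.
have meps : 1 <= 2 * eps * m%:R by nra.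
have mle : m%:R * eps <= 1 by nra.
have Nm : (m + 3 <= N)%N.
  have : 4 < (N%:R + 1) * eps.
    by apply: (lt_trans (lt_le_trans X4 qlo)); rewrite ltr_pM2r.
  by rewrite mulrDl mul1r -(ler_nat R) natrD -(ler_pM2r e0) mulrDl; lra.
have m_gt0 : (0 < m)%N.
  by rewrite lt0n; apply/eqP => m0; move: meps; rewrite m0 mulr0; lra.
have [K [p [M [NK MmK NM]]]] := odd_workspace Nm.
(* Of the 2 lost, [m * eps] costs at most 1, and the rounding of [q] together with the parity at
   most [2 * eps]. *)
have Meps : pi * window_parameter l - 2 <= eps * M%:R.
  rewrite -(ler_nat R) !natrD in NM.
  have : q * eps <= (M%:R + m%:R + 2) * eps by rewrite ler_pM2r //; lra.
  by nra.
(* With [h = eps / 2] this [b] satisfies [b * (1 - eps ^+ 2 / 2) <= 1] and gives Chebyshev growth at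
   rate [eps]. *)
pose h := eps / 2; pose b := (1 + h ^+ 2) / (1 - h ^+ 2).
have h01 : 0 <= h < 1 by rewrite /h; lra.
have h2 : 0 < 1 - h ^+ 2 by rewrite /h; nra.
have b0 : 0 <= b by rewrite divr_ge0 ?(ltW h2) // addr_ge0 ?sqr_ge0.
have b1 : b * (1 - eps ^+ 2 / 2) <= 1.
  by rewrite /b mulrAC ler_pdivrMr // mul1r /h; nra.
have T0 : 0 < chebyshev b M.
  by apply: lt_le_trans (chebyshev_moebius_ge M h01); rewrite divr_gt0 ?expR_gt0.
have [V VV tailV] := tail_probability m_gt0 MmK e0 b0 b1 T0.
exists K.*2, (estimation n p VV (fourier_unitary R K.*2)
  (fun y => `|cos (grid R y / 2)|)).
split; first by rewrite calls_estimation.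
move=> U a psi0 psi1 UU /andP[a0 a1] p0_1 p1_1 prepU.
have a_itv : -1 <= a <= 1 by lra.
pose theta := acos a.
have cos_th : cos theta = a by rewrite /theta acosK // in_itv.
have Uth : U *m target0 R n = plane psi0 psi1 theta.
  by rewrite /plane cos_th /theta sin_acos.
rewrite (prob_estimation _ UU p0_1 p1_1 Uth).
have := tailV theta; rewrite cos_th => /(_ (ltW a0)) tail.
apply: le_lt_trans tail _.
apply: (tail_probability_lt (q := q)) => //.
by apply: le_trans Nq; rewrite ler_nat NK leq_addl.
Qed.

(** The constant guess 1/2 is never off by more than 1/2; calls controlled on no label bring the
    count to [N]. *)
Lemma trivial_estimation (eps : R) (n N : nat) : 1 / 2 <= eps ->
  exists (w : nat) (A : qalg R w.+1 (n.+1 * 2)), calls A = N /\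
    forall (U : 'M[R[i]]_(n.+1 * 2)) (a : R) psi, 0 < a < 1 ->
      prob_output U (fun ahat => eps < `|ahat - a|) A psi = 0.
Proof.
move=> e2; exists 0%N, (iter N (Call finset.set0) (Output _ _ (1 / 2))); split.
  by elim: N => //= N ->.
move=> U a psi /andP[a0 a1]; elim: N psi => [|N IH] psi; last by rewrite iterS /= IH.
rewrite /= ifF //; apply/negbTE; rewrite -leNgt ler_norml; apply/andP; split; lra.
Qed.

End Final.

Lemma near_ln_inv_ge (R : realType) (c : R) :
  \forall delta \near (0 : R)^'+, 0 < delta /\ c <= ln delta^-1.
Proof.
near=> delta.
have d0 : 0 < delta by near: delta; exact: nbhs_right_gt.
have dc : delta < expR (- c) by near: delta; apply: nbhs_right_lt; exact: expR_gt0.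
split => //; rewrite -[c]expRK ler_ln ?posrE ?expR_gt0 ?invr_gt0 //.
by rewrite -[c]opprK expRN lef_pV2 ?posrE ?expR_gt0 // ltW.
Unshelve. all: by end_near. Qed.

Theorem lemma4 (R : realType) :
  exists alpha : R -> R,
    [/\ forall delta : R, 0 < delta < 1 -> 0 < alpha delta,
        (fun delta : R => alpha delta - (2 * pi)^-1 * ln (delta^-1))
          =O_ ((0 : R)^'+) (fun delta : R => ln (ln (delta^-1))),
        exists C : R, \forall delta \near (0 : R)^'+, forall eps : R, 0 < eps ->
          `|query_bound (alpha delta) eps - (2 * eps)^-1 * ln (delta^-1)|
            <= C * (eps^-1 * ln (ln (delta^-1)))
      & forall (eps delta : R) (n : nat), 0 < eps -> 0 < delta < 1 ->
          exists (w : nat) (A : qalg R w.+1 (n.+1 * 2)),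
            calls A = Num.truncn (query_bound (alpha delta) eps) /\
            forall (U : 'M[R[i]]_(n.+1 * 2)) (a : R)
                   (psi0 psi1 : 'cV[R[i]]_n.+1),
              U \is unitarymx -> 0 < a < 1 ->
              sqnorm psi0 = 1 -> sqnorm psi1 = 1 ->
              prepares U a psi0 psi1 ->
              prob_output U (fun ahat => eps < `|ahat - a|) A (init_state R w n)
                < delta].
Proof.
have ln_inv_ge0 (delta : R) : 0 < delta < 1 -> 0 <= ln delta^-1.
  by move=> /andP[d0 d1]; rewrite ln_ge0 // invf_ge1 // ltW.
exists (fun delta => window_parameter (ln delta^-1)); split.
- by move=> delta /ln_inv_ge0; exact: window_parameter_gt0.
(* The excess is at most [2 * ln l / pi], and [2 <= pi] allows the constant 1. *)
- apply/eqO_exP; exists 1 => //; near=> delta.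
  have [d0] : 0 < delta /\ kappa R <= ln delta^-1 by near: delta; exact: near_ln_inv_ge.
  move: (ln _) => l kl; rewrite mul1r.
  have /andP[lo hi] := window_parameter_asymp kl; have p2 := pi_ge2 R.
  have -> : window_parameter l - (2 * pi)^-1 * l = (pi * window_parameter l - l / 2) / pi.
    by move: (@pi R) p2 => r r2; field; rewrite gt_eqF //; lra.
  apply: le_trans (ler_norm _); rewrite ger0_norm ?divr_ge0 ?pi_ge0 //.
  by rewrite ler_pdivrMr ?pi_gt0 //; nra.
(* The summand [pi] pays for replacing the square root by [1 + alpha], as [1 <= ln l]; the summand 2
   bounds [pi * alpha - l / 2] in units of [ln l]. *)
- exists (pi + 2); near=> delta => eps e0.
  have [d0] : 0 < delta /\ kappa R <= ln delta^-1 by near: delta; exact: near_ln_inv_ge.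
  move: (ln _) => l kl; have k34 := kappa_ge34 R.
  have /andP[lo hi] := window_parameter_asymp kl; have p0 := pi_gt0 R.
  have l0 : 0 <= l by lra.
  have /andP[s1 s2] := sqrt1D_bounds (ltW (window_parameter_gt0 l0)).
  have lnl : 1 <= ln l.
    rewrite -[leLHS]expRK ler_ln ?posrE ?expR_gt0 //; last by lra.
    have : expR 1 <= expR 4 :> R by rewrite ler_expR; lra.
    by move: kl; rewrite /kappa; have := expR_gt0 (4 : R); lra.
  rewrite /query_bound; set s := Num.sqrt _ in s1 s2 *.
  have -> : pi / eps * s - (2 * eps)^-1 * l = eps^-1 * (pi * s - l / 2).
    by move: (@pi R) => r; field; rewrite gt_eqF.
  rewrite mulrCA normrM gtr0_norm ?invr_gt0 // ler_pM2l ?invr_gt0 //.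
  rewrite ger0_norm; nra.
move=> eps delta n e0 d01; have /andP[d0 d1] := d01.
have dE : expR (- ln delta^-1) = delta.
  by rewrite lnV ?posrE // opprK lnK.
have [e2|e2] := lerP (1 / 2) eps.
  have [w [A [cA pA]]] := trivial_estimation n
    (Num.truncn (query_bound (window_parameter (ln delta^-1)) eps)) e2.
  by exists w, A; split => // U a psi0 psi1 _ a01 _ _ _; rewrite pA.
have e02 : 0 < eps < 1 / 2 by rewrite e0 e2.
have [w [A [cA pA]]] := exists_estimation n (ln_inv_ge0 _ d01) e02 erefl.
exists w, A; split => // U a psi0 psi1 UU a01 p0 p1 prep.
by rewrite -[ltRHS]dE; exact: pA prep.
Unshelve. all: by end_near. Qed.
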